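(* Let $H=([n],\mathcal{I})$ be an interval hypergraph and let $t:\mathcal{I}\to[n]$ be any function with $t(I)\in I$ for all $I\in\mathcal{I}$. Then the co-occurrence graph $\Gamma_t$ is perfect.
   Context: For integers $i\le j$ in $[n]=\{1,\dots,n\}$, the interval $\{i,i+1,\dots,j\}$ is a subset of $[n]$. An interval hypergraph is a hypergraph $H=([n],\mathcal{I})$ whose hyperedge set $\mathcal{I}$ is a family of such intervals. For a function $t:\mathcal{I}\to[n]$ with $t(I)\in I$, with image $R=t(\mathcal{I})$, the co-occurrence graph $\Gamma_t$ is the simple graph on vertex set $R$ in which distinct $u,v\in R$ are adjacent iff there is an $I\in\mathcal{I}$ with $u,v\in I$ and $t(I)\in\{u,v\}$. A graph is perfect if for every induced subgraph the chromatic number equals the clique number. *)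

(* Defs.v *)
From HB Require Import structures.
From mathcomp Require Import all_boot.

Set Implicit Arguments.
Unset Strict Implicit.
Unset Printing Implicit Defensive.

Record sgraph := SGraph {
  vertex : finType;
  adj : rel vertex;
  adj_sym : symmetric adj;
  adj_irrefl : irreflexive adj
}.

Section SimpleGraphs.
Variable G : sgraph.

Definition induced_adj (S : {set vertex G}) : rel {x : vertex G | x \in S} :=
  fun u v => adj (val u) (val v).

Lemma induced_adj_sym S : symmetric (@induced_adj S).
Proof. by move=> u v; apply: adj_sym. Qed.

Lemma induced_adj_irrefl S : irreflexive (@induced_adj S).
Proof. by move=> u; apply: adj_irrefl. Qed.

Definition induced (S : {set vertex G}) : sgraph :=
  SGraph (@induced_adj_sym S) (@induced_adj_irrefl S).

Definition colorable (k : nat) : bool :=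
  [exists c : {ffun vertex G -> 'I_k},
    [forall u, forall v, adj u v ==> (c u != c v)]].

Lemma ex_colorable : exists k, colorable k.
Proof.
exists #|vertex G|; apply/existsP; exists [ffun u => enum_rank u].
apply/forallP=> u; apply/forallP=> v; apply/implyP=> uv; rewrite !ffunE.
by apply: contraTneq uv => /enum_rank_inj ->; rewrite adj_irrefl.
Qed.

Definition chromatic_number : nat := ex_minn ex_colorable.

Definition clique (K : {set vertex G}) : bool :=
  [forall u in K, forall v in K, (u != v) ==> adj u v].

Definition clique_number : nat := \max_(K : {set vertex G} | clique K) #|K|.

End SimpleGraphs.

Definition perfect (G : sgraph) : Prop :=
  forall S : {set vertex G},
    chromatic_number (induced S) = clique_number (induced S).

(* The ground set [n] = {1, ..., n} is represented by 'I_n, with the point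
   i.+1 of [n] encoded as the ordinal i; only the order of [n] matters. *)
Definition interval n (i j : 'I_n) : {set 'I_n} := [set k : 'I_n | i <= k <= j].

Definition is_interval n (I : {set 'I_n}) : Prop :=
  exists i j : 'I_n, i <= j /\ I = interval i j.

Definition interval_hypergraph n (E : {set {set 'I_n}}) : Prop :=
  forall I, I \in E -> is_interval I.

Section CoOccurrence.
Variables (n : nat) (E : {set {set 'I_n}}).
(* The subtype makes the domain of t exactly the set E of hyperedges; in
   particular t exists when E is empty, even if n = 0. *)
Variable t : {I : {set 'I_n} | I \in E} -> 'I_n.

Definition image_set : {set 'I_n} :=
  [set t I | I : {I : {set 'I_n} | I \in E}].

Definition cooccurrence_adj : rel {u : 'I_n | u \in image_set} :=
  fun u v => (u != v) &&
    [exists I : {I : {set 'I_n} | I \in E},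
      [&& val u \in val I, val v \in val I & t I \in [set val u; val v]]].

Lemma cooccurrence_adj_sym : symmetric cooccurrence_adj.
Proof.
move=> u v; rewrite /cooccurrence_adj eq_sym; congr (_ && _).
by apply: eq_existsb => I; rewrite andbCA setUC.
Qed.

Lemma cooccurrence_adj_irrefl : irreflexive cooccurrence_adj.
Proof. by move=> u; rewrite /cooccurrence_adj eqxx. Qed.

Definition cooccurrence_graph : sgraph :=
  SGraph cooccurrence_adj_sym cooccurrence_adj_irrefl.

End CoOccurrence.

(* Main.v *)
(** Vertices are ordered as points of [n].  If [u < v < w] and [u], [w] are
    adjacent through an interval [I], then [v] lies in [I] as well, so [v] is
    adjacent to whichever of [u], [w] equals [t I].  Hence non-adjacency,
    directed along the order, is a strict partial order; colourings are
    partitions into chains and cliques are antichains, and the claim is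
    Dilworth's theorem, proved here by Galvin's induction. *)

Require Import Defs.
From mathcomp Require Import all_boot.

Set Implicit Arguments.
Unset Strict Implicit.
Unset Printing Implicit Defensive.

(** * Dilworth's theorem for finite strict partial orders *)

Section Dilworth.
Variables (T : finType) (lt : rel T).
Hypotheses (lt_irr : irreflexive lt) (lt_trans : transitive lt).

Definition antichain (A : {set T}) : bool :=
  [forall x in A, forall y in A, ~~ lt x y].

(** A cover of [S] by at most [k] chains, encoded by total colourings constrained only on [S], so
    that colourings of subsets can be glued pointwise. *)
Definition chain_coloring (S : {set T}) (k : nat) (c : T -> nat) : Prop :=
  {in S, forall x, c x < k} /\
  {in S &, forall x y, c x = c y -> [|| x == y, lt x y | lt y x]}.

Lemma antichainP (A : {set T}) :
  reflect {in A &, forall x y, ~~ lt x y} (antichain A).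
Proof.
apply: (iffP forall_inP) => [H x y xA yA | H x xA].
  by move/forall_inP: (H x xA); apply.
by apply/forall_inP => y yA; apply: H.
Qed.

Lemma exists_maximal (P : pred T) x0 :
  P x0 -> exists2 x, P x & forall y, P y -> ~~ lt x y.
Proof.
(* The number of predecessors strictly increases along [lt], so a point of [P] maximizing it is
   maximal. *)
move=> Px0; case: (@arg_maxnP _ x0 P (fun x => #|[set y | lt y x]|) Px0).
move=> x Px xmax; exists x => // y Py; apply/negP => xy.
suff lt_xy : #|[set z | lt z x]| < #|[set z | lt z y]|.
  by have:= leq_trans lt_xy (xmax y Py); rewrite ltnn.
apply/proper_card/properP; split.
  by apply/subsetP => z; rewrite !inE => /lt_trans; apply.
by exists x; rewrite !inE ?lt_irr.
Qed.

(** Two points of an antichain never share a colour, so by counting [k] of them use all [k]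
    colours. *)
Lemma full_antichain_meets_chain (S A : {set T}) k c i :
  chain_coloring S k c -> A \subset S -> antichain A -> #|A| = k -> i < k ->
  exists2 y, y \in A & c y = i.
Proof.
move=> [ck cC] /subsetP AS /antichainP anti cardA ik.
have k_gt0 : 0 < k by apply: leq_ltn_trans ik.
case: k k_gt0 ik cardA ck => // k _ ik cardA ck.
pose g x : 'I_k.+1 := inord (c x).
have g_inj : {in A &, injective g}.
  move=> x y xA yA /(congr1 val); rewrite /= !inordK ?ck ?AS // => cxy.
  case/or3P: (cC x y (AS _ xA) (AS _ yA) cxy) => [/eqP // | |] xy.
    by have:= anti x y xA yA; rewrite xy.
  by have:= anti y x yA xA; rewrite xy.
have : inord i \in g @: A.
  suff -> : g @: A = setT by rewrite inE.
  by apply/eqP; rewrite eqEcard subsetT cardsT card_ord card_in_imset ?cardA /=.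
case/imsetP => y yA /(congr1 val); rewrite /= !inordK ?ck ?AS // => ->.
by exists y.
Qed.

Theorem dilworth (S : {set T}) :
  exists k c (A : {set T}),
    [/\ A \subset S, antichain A, #|A| = k & chain_coloring S k c].
Proof.
have [m] := ubnP #|S|; elim: m S => // m IH S leSm.
have [->|[a0 a0S]] := set_0Vmem S.
  exists 0, (fun=> 0), set0; split; rewrite ?cards0 //.
    by apply/antichainP => x y; rewrite inE.
  by split=> x; rewrite inE.
have [a aS amax] := exists_maximal (P := [in S]) a0S.
pose S' := S :\ a.
have S'S : S' \subset S := subsetDl _ _.
have ltS'm : #|S'| < m by move: leSm; rewrite (cardsD1 a S) aS.
have [k [c [A0 [A0S' anti0 card0 col]]]] := IH S' ltS'm.
have [ck cC] := col.
(* Since [k] chains cover [S'], these are the antichains of maximum size in [S']. *)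
pose full (B : {set T}) := [&& B \subset S', antichain B & #|B| == k].
have fullMeets B i : full B -> i < k -> exists2 y, y \in B & c y = i.
  by case/and3P=> BS antiB /eqP cB; apply: full_antichain_meets_chain col _ _ _.
(* [top i x]: [x] is the largest element of chain [i] lying in some antichain
   of maximum size. *)
pose cand (i : nat) x := (c x == i) && [exists B, full B && (x \in B)].
have candS i x : cand i x -> x \in S'.
  by case/andP=> _ /existsP[B /andP[/and3P[/subsetP BS _ _]]]; apply: BS.
pose top (i : nat) x :=
  cand i x && [forall y, cand i y ==> ((y == x) || lt y x)].
have top_ex i : i < k -> exists x, top i x.
  move=> ik.
  have full0 : full A0 by rewrite /full A0S' anti0 card0 eqxx.
  have [y yA cy] := fullMeets _ _ full0 ik.
  have candy : cand i y.
    by rewrite /cand cy eqxx; apply/existsP; exists A0; rewrite full0.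
  (* Candidates of one colour are pairwise comparable, so a maximal one is the largest. *)
  have [x candx xmax] := exists_maximal candy.
  exists x; rewrite /top candx; apply/forall_inP => z candz.
  have czx : c z = c x.
    by case/andP: candx => /eqP->; case/andP: candz => /eqP->.
  case/or3P: (cC z x (candS _ _ candz) (candS _ _ candx) czx) => [->|->|xz] //.
    by rewrite orbT.
  by have:= xmax z candz; rewrite xz.
have top_above i x B : i < k -> top i x -> full B ->
    exists2 y, y \in B & (c y = i) /\ ((y == x) || lt y x).
  move=> ik /andP[_ /forall_inP xtop] fB; have [y yB cy] := fullMeets _ _ fB ik.
  exists y => //; split=> //; apply: xtop.
  by rewrite /cand cy eqxx; apply/existsP; exists B; rewrite fB.
have f_ex (i : 'I_k) : exists x, top i x by apply: top_ex.
pose f i := xchoose (f_ex i).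
have fP (i : 'I_k) : top i (f i) := xchooseP (f_ex i).
have fcand (i : 'I_k) : cand i (f i) by case/andP: (fP i).
have fc (i : 'I_k) : c (f i) = i by case/andP: (fcand i) => /eqP.
have fS' i : f i \in S' := candS _ _ (fcand i).
have f_inj : injective f.
  by move=> i j fij; apply: val_inj; rewrite /= -!fc fij.
have f_anti (i j : 'I_k) : ~~ lt (f i) (f j).
  (* A full antichain through [f j] meets chain [i] at some [y] at or below [f i]; then [y] would
     lie below [f j] inside that antichain. *)
  apply/negP => fij.
  case/andP: (fcand j) => _ /existsP[B /andP[fB fjB]].
  have [y yB [_ yfi]] := top_above _ _ _ (ltn_ord i) (fP i) fB.
  case/and3P: fB => _ /antichainP/(_ y (f j) yB fjB)/negP + _; apply.
  by case/orP: yfi => [/eqP-> // | /lt_trans]; apply.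
pose A := f @: 'I_k.
have cardA : #|A| = k by rewrite card_imset // card_ord.
have AS' : A \subset S' by apply/subsetP => _ /imsetP[i _ ->].
have antiA : antichain A.
  by apply/antichainP => _ _ /imsetP[i _ ->] /imsetP[j _ ->].
have [/existsP[i fia]|/existsPn no_fa] := boolP [exists i, lt (f i) a];
  last first.
  (* No [f i] is below [a], and [a] is maximal, so [a] extends the antichain; it forms a chain
     alone, with the fresh colour [k]. *)
  exists k.+1, (fun x => if x == a then k else c x), (a |: A); split.
  - by rewrite subUset sub1set aS (subset_trans AS').
  - apply/antichainP => x y /setU1P[->|xA] /setU1P[->|yA].
    + by rewrite lt_irr.
    + by apply/amax/(subsetP S'S)/(subsetP AS').
    + by case/imsetP: xA => i _ ->.
    + by move/antichainP: antiA; apply.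
  - by rewrite cardsU1 cardA (contraNN (subsetP AS' a)) // setD11.
  - have S'E x : x \in S -> x != a -> x \in S' by rewrite !inE => -> ->.
    split=> [x xS | x y xS yS]; first by case: eqVneq => // /(S'E x xS)/ck/ltnW.
    case: (eqVneq x a) => [->|xa]; case: (eqVneq y a) => [->|ya] //.
    + by move=> e; have:= ck y (S'E y yS ya); rewrite -e ltnn.
    + by move=> e; have:= ck x (S'E x xS xa); rewrite e ltnn.
    + by apply: cC; apply: S'E.
(* The part of chain [i] up to [f i], capped by [a]: still a chain because [f i] is below [a]. *)
pose K := a |: [set x in S' | (c x == i) && ((x == f i) || lt x (f i))].
have SDS' : S :\: K \subset S'.
  apply/subsetP => x; rewrite !inE negb_or -andbA => /and3P[-> _ ->] //.
have [|k2 [c2 [A2 [A2S anti2 card2 [c2k c2C]]]]] := IH (S :\: K).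
  exact: leq_ltn_trans (subset_leq_card SDS') ltS'm.
(* Removing [K] lowers the width: an antichain of size at least [k] in the rest contains a full one,
   whose point of colour [i] is at or below [f i], hence in [K]. *)
have lt_k2 : k2 < k.
  rewrite ltnNge; apply/negP => le_k.
  have [B BA cB] : exists2 B : {set T}, B \subset A2 & #|B| = k.
    have : 0 < #|[set B : {set T} | B \subset A2 & #|B| == k]|.
      by rewrite cards_draws card2 bin_gt0.
    by case/card_gt0P => B; rewrite inE => /andP[? /eqP ?]; exists B.
  have fB : full B.
    rewrite /full cB eqxx (subset_trans BA (subset_trans A2S SDS')) andbT.
    apply/antichainP => x y /(subsetP BA) xA /(subsetP BA) yA.
    by move/antichainP: anti2; apply.
  have [y yB [cy yfi]] := top_above _ _ _ (ltn_ord i) (fP i) fB.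
  have ySK := subsetP A2S _ (subsetP BA _ yB).
  have yS' := subsetP SDS' _ ySK.
  case/setDP: ySK => _ /negP; apply.
  by rewrite in_setU1 inE yS' cy eqxx yfi orbT.
have K_lt_a x : x \in K -> x != a -> lt x a.
  rewrite in_setU1 => /orP[->//|]; rewrite inE.
  case/and3P=> _ _ /orP[/eqP->|xf] _ //.
  exact: lt_trans xf fia.
have K_chain : {in K &, forall x y, [|| x == y, lt x y | lt y x]}.
  move=> x y xK yK.
  have [xa|xa] := eqVneq x a; have [ya|ya] := eqVneq y a.
  - by rewrite xa ya eqxx.
  - by rewrite xa (K_lt_a y) ?orbT.
  - by rewrite ya (K_lt_a x) ?orbT.
  - move: xK yK; rewrite !in_setU1 (negPf xa) (negPf ya) /= 2!inE.
    by move=> /and3P[xS /eqP cx _] /and3P[yS /eqP cy _]; apply: cC; rewrite ?cx.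
(* Off [K] the colours are below [k2], so [k2] is free for [K], and [k2 < k] keeps the total within
   [k], the size of [A]. *)
exists k, (fun x => if x \in K then k2 else c2 x), A; split=> //.
  exact: subset_trans S'S.
split=> [x xS | x y xS yS].
  case: ifPn => // xK; apply: ltn_trans lt_k2; apply: c2k.
  by rewrite inE xK.
case: ifPn => xK; case: ifPn => yK.
- by move=> _; apply: K_chain.
- by move=> e; have:= c2k y; rewrite inE yK yS -e ltnn => /(_ isT).
- by move=> e; have:= c2k x; rewrite inE xK xS e ltnn => /(_ isT).
- by apply: c2C; rewrite inE ?xK ?yK.
Qed.

End Dilworth.

(** * Chromatic and clique numbers of cocomparability graphs *)

Lemma clique_leq_colorable (G : sgraph) (K : {set vertex G}) k :
  clique K -> colorable G k -> #|K| <= k.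
Proof.
move=> /forall_inP cK /existsP[c /forallP cP].
rewrite -[k]card_ord -(@card_in_imset _ _ c) ?max_card // => u v uK vK cuv.
apply: contraTeq isT => uv; move/forallP/(_ v): (cP u).
by rewrite cuv eqxx; move/forall_inP/(_ v vK): (cK u uK); rewrite uv /= => ->.
Qed.

(** Only the equality for [G] itself is proved: the order restricts to any vertex subset, so
    perfection follows by applying this to each induced subgraph. *)
Lemma cocomparability_chromatic_number (G : sgraph) (lt : rel (vertex G)) :
  irreflexive lt -> transitive lt ->
  (forall u v, u != v -> adj u v = ~~ (lt u v || lt v u)) ->
  chromatic_number G = clique_number G.
Proof.
move=> lt_irr lt_trans adjE; apply/eqP; rewrite eqn_leq; apply/andP; split.
  have [k [c [A [_ /antichainP antiA <- [ck cC]]]]] :=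
    dilworth lt_irr lt_trans setT.
  have cliqueA : clique A.
    apply/forall_inP => u uA; apply/forall_inP => v vA; apply/implyP => uv.
    by rewrite adjE // negb_or !antiA.
  apply: leq_trans (leq_bigmax_cond _ cliqueA).
  rewrite /chromatic_number; case: ex_minnP => m _; apply.
  have ckT x : c x < #|A| by apply: ck; rewrite inE.
  apply/existsP; exists [ffun u => Ordinal (ckT u)].
  apply/forallP => u; apply/forallP => v; apply/implyP => uv; rewrite !ffunE.
  apply: contraTneq uv => /(congr1 val) /= cuv.
  have [->|neq_uv] := eqVneq u v; first by rewrite adj_irrefl.
  have:= cC u v (in_setT u) (in_setT v) cuv.
  by rewrite (negPf neq_uv) adjE //= => ->.
rewrite /chromatic_number; case: ex_minnP => k colk _.
by apply/bigmax_leqP => K cK; apply: clique_leq_colorable colk.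
Qed.

(** * The order of non-adjacency in a co-occurrence graph *)

Section Cooccurrence.
Variables (n : nat) (E : {set {set 'I_n}}).
Variable t : {I : {set 'I_n} | I \in E} -> 'I_n.
Hypothesis intervalE : interval_hypergraph E.
Local Notation adj := (@cooccurrence_adj n E t).

Lemma cooccurrence_adj_between (u v w : {x | x \in image_set t}) :
  val u < val v -> val v < val w -> adj u w -> adj u v || adj v w.
Proof.
move=> uv vw /andP[_ /existsP[I /and3P[uI wI tI]]].
have vI : val v \in val I.
  have [i [j [_ eI]]] := intervalE (valP I).
  move: uI wI; rewrite eI !inE => /andP[iu _] /andP[_ wj].
  by rewrite (leq_trans iu (ltnW uv)) (leq_trans (ltnW vw) wj).
have neq_lt (x y : {x | x \in image_set t}) : val x < val y -> x != y.
  by apply: contraTneq => ->; rewrite ltnn.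
case/set2P: tI => tI; apply/orP; [left|right]; apply/andP; split.
- exact: neq_lt.
- by apply/existsP; exists I; rewrite uI vI tI set21.
- exact: neq_lt.
- by apply/existsP; exists I; rewrite vI wI tI set22.
Qed.

Definition precedes_nonadj : rel {x | x \in image_set t} :=
  fun u v => (val u < val v) && ~~ adj u v.

(** This is the contrapositive of [cooccurrence_adj_between]. *)
Lemma precedes_nonadj_trans : transitive precedes_nonadj.
Proof.
rewrite /precedes_nonadj => v u w /andP[uv nuv] /andP[vw nvw].
rewrite (ltn_trans uv vw) /=.
by apply: contra nuv => /(cooccurrence_adj_between uv vw);
  rewrite (negPf nvw) orbF.
Qed.

End Cooccurrence.

Theorem theorem5 (n : nat) (E : {set {set 'I_n}})
    (t : {I : {set 'I_n} | I \in E} -> 'I_n) :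
  interval_hypergraph E ->
  (forall I : {I : {set 'I_n} | I \in E}, t I \in val I) ->
  perfect (cooccurrence_graph t).
Proof.
move=> intervalE _ S.
apply: (@cocomparability_chromatic_number (induced S)
          [rel u v | precedes_nonadj (val u) (val v)]).
- by move=> u; rewrite /= /precedes_nonadj ltnn.
- by move=> v u w; apply: precedes_nonadj_trans.
move=> u v neq_uv; rewrite /= /induced_adj /precedes_nonadj /=.
rewrite (cooccurrence_adj_sym (val v)) -andb_orl negb_and negbK.
(* Distinct vertices are distinct points of the linear order, seen through the two nested subtypes,
   so one of the two directions always applies. *)
suff -> : (val (val u) < val (val v)) || (val (val v) < val (val u)) by [].
by rewrite -neq_ltn !(inj_eq val_inj).
Qed.
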